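(* In intensional Martin-Löf type theory, assume that every type has a constant endofunction, i.e. $\prod_{A:\mathcal U}\sum_{k:A\to A}\prod_{a,b:A}k(a)=k(b)$. Then for every type $X:\mathcal U$ and every relation $R:X\times X\to\mathcal U$ there is a relation $S:X\times X\to\mathcal U$ such that: (i) $S$ is propositionally valued: $\prod_{x,y:X}\mathrm{isProp}(S(x,y))$; (ii) $S$ is functional: $\prod_{x:X}\mathrm{isProp}\big(\sum_{y:X}S(x,y)\big)$; (iii) $S$ is a subrelation of $R$: $\prod_{x,y:X}S(x,y)\to R(x,y)$; (iv) $S$ and $R$ have the same domain: for every $x:X$, $\big(\sum_{y:X}R(x,y)\big)\Leftrightarrow\big(\sum_{y:X}S(x,y)\big)$.
   Context: Intensional Martin-Löf type theory with a universe $\mathcal U$ (and a larger universe containing it as needed), $\Sigma$, $\Pi$, $+$, $\mathbf 0$, $\mathbf 2$ and identity types (J only; no UIP/K). $\mathrm{isProp}(A):\equiv\prod_{a,b:A}a=b$. $A\Leftrightarrow B$ means there are maps in both directions. *)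

(* Defs.v *)
(** One fixed universe [UU]; every type of the object theory lives in it. *)
Definition UU := Type.

(** The identity type is an inductive family in [UU] rather than the
    [Prop]-valued [eq]; its eliminator [Id_rect] is J. *)
Inductive Id {A : UU} (a : A) : A -> UU :=
  idrefl : Id a a.

Definition isProp (A : UU) : UU := forall a b : A, Id a b.

Definition constEndo (A : UU) : UU :=
  {k : A -> A & forall a b : A, Id (k a) (k b)}.

(** [A <-> B] of the standard library is available for [Prop] only. *)
Definition logEquiv (A B : UU) : UU := ((A -> B) * (B -> A))%type.

(* Main.v *)
Require Import Defs.

(** For each [x] let [k] be a constant endofunction of [{y & R (x, y)}], and let
    [S (x, y)] consist of the [r : R (x, y)] such that [(y, r)] is a fixed point
    of [k].  The fixed points of a constant function form a proposition, which
    is inhabited as soon as its domain is; this gives functionality and equality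
    of domains.  Constant endofunctions on the identity types of [X] make [X] a
    set (Hedberg), and over a set, functionality implies that [S] is
    propositionally valued. *)

Definition idsym {A : UU} {a b : A} (p : Id a b) : Id b a :=
  match p in Id _ b return Id b a with idrefl _ => idrefl a end.

Definition idtrans {A : UU} {a b c : A} (p : Id a b) (q : Id b c) : Id a c :=
  match q in Id _ c return Id a c with idrefl _ => p end.

Definition idap {A B : UU} (f : A -> B) {a b : A} (p : Id a b) :
  Id (f a) (f b) :=
  match p in Id _ b return Id (f a) (f b) with idrefl _ => idrefl (f a) end.

Definition idtransport {A : UU} (P : A -> UU) {a b : A} (p : Id a b) :
  P a -> P b :=
  match p in Id _ b return P a -> P b with idrefl _ => fun u => u end.

Lemma idtrans_symKl {A : UU} {a b c : A} (p : Id a b) (q : Id b c) :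
  Id (idtrans (idsym p) (idtrans p q)) q.
Proof. destruct q; destruct p; exact (idrefl _). Defined.

Lemma isProp_retract {A B : UU} (f : A -> B) (g : B -> A)
  (gf : forall a : A, Id (g (f a)) a) : isProp B -> isProp A.
Proof.
  intros propB a b.
  exact (idtrans (idsym (gf a)) (idtrans (idap g (propB (f a) (f b))) (gf b))).
Defined.

Lemma isProp_singleton {A : UU} (a : A) : isProp {b : A & Id a b}.
Proof. intros [b p] [c q]; destruct p, q; exact (idrefl _). Defined.

Lemma isProp_fixpoints {A : UU} (k : A -> A)
  (kconst : forall a b : A, Id (k a) (k b)) : isProp {a : A & Id (k a) a}.
Proof.
  (* Once a point [a0] is given, [Id (k a) a] may be replaced by [Id (k a0) a],
     so the type of fixed points is a retract of a singleton. *)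
  enough (base : A -> isProp {a : A & Id (k a) a})
    by (intros u; exact (base (projT1 u) u)).
  intros a0.
  apply (isProp_retract (B := {a : A & Id (k a0) a})
    (fun u => existT _ (projT1 u) (idtrans (kconst a0 (projT1 u)) (projT2 u)))
    (fun v => existT _ (projT1 v)
                (idtrans (idsym (kconst a0 (projT1 v))) (projT2 v)))).
  - intros [a p]; cbn.
    exact (idap (existT (fun a => Id (k a) a) a)
             (idtrans_symKl (kconst a0 a) p)).
  - apply isProp_singleton.
Defined.

(** Each [p] is recovered from [k c p] by composing with the inverse of [k a (idrefl a)]. Since
    [k b] is constant on [Id a b], the recovered values all agree. *)
Lemma hedberg {A : UU} (K : forall a b : A, constEndo (Id a b)) (a b : A) :
  isProp (Id a b).
Proof.
  pose (k := fun c => projT1 (K a c)).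
  (* The endpoint [c] stays free so that J reduces the claim to reflexivity, where the inverse
     cancels. *)
  assert (canon : forall c (p : Id a c),
            Id (idtrans (idsym (k a (idrefl a))) (k c p)) p).
  { intros c p; destruct p.
    exact (idtrans_symKl (k a (idrefl a)) (idrefl a)). }
  intros p q.
  exact (idtrans (idsym (canon b p))
           (idtrans (idap (idtrans (idsym (k a (idrefl a))))
                       (projT2 (K a b) p q))
              (canon b q))).
Defined.

(** Identifying [(a, s)] with [(a, t)] gives a loop at [a] transporting [s] to [t]; in a set this
    loop is trivial. *)
Lemma isProp_fiber {A : UU} (setA : forall a b : A, isProp (Id a b))
  (P : A -> UU) (propP : isProp {a : A & P a}) (a : A) : isProp (P a).
Proof.
  intros s t.
  (* The second pair is generalised to [v] to make J applicable. *)
  assert (over : forall v : {a : A & P a}, Id (existT P a s) v ->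
            {p : Id a (projT1 v) & Id (idtransport P p s) (projT2 v)}).
  { intros v e; destruct e; exact (existT _ (idrefl a) (idrefl s)). }
  destruct (over (existT P a t) (propP _ _)) as [p e]; cbn in p, e.
  exact (idtrans (idap (fun p => idtransport P p s) (setA a a (idrefl a) p)) e).
Defined.

Theorem theorem7p3 (constEndo_all : forall A : UU, constEndo A)
  (X : UU) (R : X * X -> UU) :
  {S : X * X -> UU &
    ((forall x y : X, isProp (S (x, y))) *
     (forall x : X, isProp {y : X & S (x, y)}) *
     (forall x y : X, S (x, y) -> R (x, y)) *
     (forall x : X, logEquiv {y : X & R (x, y)} {y : X & S (x, y)}))%type}.
Proof.
  pose (T := fun x => {y : X & R (x, y)}).
  pose (k := fun x => projT1 (constEndo_all (T x))).
  pose (kconst := fun x => projT2 (constEndo_all (T x))).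
  pose (S := fun '(x, y) =>
    {r : R (x, y) &
      Id (k x (existT (fun y => R (x, y)) y r)) (existT _ y r)}).
  assert (functional : forall x, isProp {y : X & S (x, y)}).
  { intros x.
    (* Reassociate [(y, (r, e))] as the fixed point [(y, r)] with its proof [e]. *)
    apply (isProp_retract (B := {u : T x & Id (k x u) u})
      (fun w => existT (fun u => Id (k x u) u)
                  (existT _ (projT1 w) (projT1 (projT2 w)))
                  (projT2 (projT2 w)))
      (fun v => match v with
                | existT _ (existT _ y r) e =>
                    existT (fun y => S (x, y)) y (existT _ r e)
                end)).
    - intros [y [r e]]; exact (idrefl _).
    - exact (isProp_fixpoints (k x) (kconst x)). }
  exists S; repeat split.
  - intros x.
    exact (isProp_fiber (hedberg (fun a b => constEndo_all (Id a b)))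
             (fun y => S (x, y)) (functional x)).
  - exact functional.
  - intros x y s; exact (projT1 s).
  - intros u.
    (* By constancy each value of [k x] is a fixed point; stated before the case split so that it
       specialises to [(y, r)]. *)
    assert (fix_k : Id (k x (k x u)) (k x u)) by exact (kconst x _ _).
    destruct (k x u) as [y r]; exact (existT _ y (existT _ r fix_k)).
  - intros [y [r _]]; exact (existT _ y r).
Qed.
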